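(* Let $(\Omega,\Sigma,\nu)$ be a probability space, let $\alpha$ be a continuous normalized gauge norm on $L^{\infty}(\Omega,\nu)$, and let $\varepsilon>0$. Then there exist a constant $c$ with $1-\varepsilon<c\leq 1$ and a probability measure $\lambda$ on $\Sigma$ that is mutually absolutely continuous with respect to $\nu$ such that $\alpha$ is $c\Vert\cdot\Vert_{1,\lambda}$-dominating.
   Context: A norm $\alpha$ on $L^{\infty}(\Omega,\nu)$ (complex-valued functions) is a normalized gauge norm if $\alpha(1)=1$ and $\alpha(|f|)=\alpha(f)$ for every $f\in L^\infty(\Omega,\nu)$. It is continuous if $\alpha(\chi_{E_n})\to 0$ whenever $\{E_n\}$ is a sequence in $\Sigma$ with $\nu(E_n)\to 0$. For a probability measure $\lambda$ mutually absolutely continuous with respect to $\nu$ (so $L^\infty(\Omega,\lambda)=L^\infty(\Omega,\nu)$) and $c>0$, $\alpha$ is $c\Vert\cdot\Vert_{1,\lambda}$-dominating if $\alpha(f)\geq c\Vert f\Vert_{1,\lambda}=c\int_\Omega|f|\,d\lambda$ for every $f\in L^{\infty}(\Omega,\nu)$. *)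

(* Defs.v *)
From HB Require Import structures.
From mathcomp Require Import all_boot all_order all_algebra.
From mathcomp Require Import all_classical all_reals all_analysis.
From mathcomp Require Export complex.

Set Implicit Arguments.
Unset Strict Implicit.
Unset Printing Implicit Defensive.

Import Order.TTheory GRing.Theory Num.Theory.
Import numFieldNormedType.Exports.
Export Normc.

Local Open Scope classical_set_scope.
Local Open Scope ring_scope.

Section gauge_norms.
Context (d : measure_display) (T : measurableType d) (R : realType).
Variable nu : probability T R.

(* Elements of the complex space L^oo(nu) are handled through their
   representatives f : T -> R[i]; classes modulo nu-a.e. equality appear in
   Linfty_norm_ae and Linfty_norm_eq0 below. Here normc is the R-valued modulus
   and Borel measurability of f is measurability of its two coordinates. *)
Record Linfty (f : T -> R[i]) : Prop := {
  Linfty_measurable_Re : measurable_fun [set: T] (fun x => complex.Re (f x)) ;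
  Linfty_measurable_Im : measurable_fun [set: T] (fun x => complex.Im (f x)) ;
  Linfty_finite_norm : finite_norm nu +oo%E (fun x => normc (f x)) }.

Record Linfty_norm (alpha : (T -> R[i]) -> R) : Prop := {
  Linfty_norm_ae : forall f g, Linfty f -> Linfty g ->
    f = g %[ae nu] -> alpha f = alpha g ;
  Linfty_norm_ge0 : forall f, Linfty f -> 0 <= alpha f ;
  Linfty_norm_eq0 : forall f, Linfty f ->
    alpha f = 0 -> f = (fun=> 0) %[ae nu] ;
  Linfty_normD : forall f g, Linfty f -> Linfty g ->
    alpha (fun x => f x + g x) <= alpha f + alpha g ;
  Linfty_normZ : forall (a : R[i]) f, Linfty f ->
    alpha (fun x => a * f x) = normc a * alpha f }.

(* On R[i], `|z| is the modulus of z seen as a complex number. *)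
Record normalized_gauge_norm (alpha : (T -> R[i]) -> R) : Prop := {
  gauge_norm_norm : Linfty_norm alpha ;
  gauge_norm1 : alpha (fun=> 1) = 1 ;
  gauge_norm_abs : forall f, Linfty f -> alpha (fun x => `|f x|) = alpha f }.

Definition continuous_norm (alpha : (T -> R[i]) -> R) : Prop :=
  forall E : nat -> set T, (forall n, measurable (E n)) ->
    nu (E n) @[n --> \oo] --> 0%E ->
    alpha (\1_(E n) : T -> R[i]) @[n --> \oo] --> (0 : R).

Definition mutually_ac (lambda : probability T R) : Prop :=
  lambda `<< nu /\ nu `<< lambda.

(* The integral is extended-real valued, hence the comparison in \bar R. *)
Definition L1_dominating (c : R) (lambda : probability T R)
    (alpha : (T -> R[i]) -> R) : Prop :=
  0 < c /\ forall f, Linfty f ->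
    (c%:E * \int[lambda]_x (normc (f x))%:E <= (alpha f)%:E)%E.

End gauge_norms.

(* Main.v *)
(* Call a measure mu dominated when int |f| dmu <= alpha f for all f in L^oo.
   The gauge property makes alpha monotone in |f|, so f |-> alpha (f^+) is
   sublinear on real L^oo; a linear functional below it is positive, and by
   continuity of alpha it comes from a dominated measure, which is absolutely
   continuous with respect to nu.  Hahn-Banach thus yields, for each measurable
   E, a dominated mu with mu E = alpha 1_E; E = T gives a dominated probability.
   As alpha 1_E > 0 when nu E > 0 and dominated measures are stable under
   countable convex combinations, an exhaustion argument produces a dominated
   measure equivalent to nu.  Mixing a small multiple of it into the dominated
   probability and normalising gives lambda, and c is the mass before
   normalisation. *)

Require Import Defs.
From HB Require Import structures.
From mathcomp Require Import all_boot all_order all_algebra.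
From mathcomp Require Import all_classical all_reals all_analysis.
From mathcomp Require Import ess_sup_inf measurable_realfun ring lra.

Set Implicit Arguments.
Unset Strict Implicit.
Unset Printing Implicit Defensive.

Import Order.TTheory GRing.Theory Num.Theory.
Import numFieldNormedType.Exports.
Import HBNNSimple.

Local Open Scope classical_set_scope.
Local Open Scope ring_scope.

(** * Hahn-Banach for sublinear functionals on a subspace *)

Section hahn_banach.
Context (R : realType) (V : lmodType R) (D : set V).
Hypothesis D0 : D 0.
Hypothesis DD : forall x y, D x -> D y -> D (x + y).
Hypothesis DZ : forall (t : R) x, D x -> D (t *: x).

(** The subspace [D] is a subset of [V] and functionals are total on [V], so every axiom is relative
    to [D]. The inequality for scalars upgrades to equality by applying it to [t^-1] as well. *)
Definition sublinear (q : V -> R) :=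
  (forall x y, D x -> D y -> q (x + y) <= q x + q y) /\
  (forall t x, D x -> 0 <= t -> q (t *: x) <= t * q x).

Let DN x : D x -> D (- x).
Proof. by move=> Dx; rewrite -scaleN1r; exact: DZ. Qed.

Lemma sublinear0 q : sublinear q -> q 0 = 0.
Proof.
move=> [qD qZ]; apply/eqP; rewrite eq_le; apply/andP; split.
  by have := qZ 0 _ D0 (lexx 0); rewrite scale0r mul0r.
by have := qD _ _ D0 D0; rewrite addr0; lra.
Qed.

Lemma sublinearN q x : sublinear q -> D x -> - q (- x) <= q x.
Proof.
move=> sq Dx; have := sq.1 _ _ Dx (DN Dx).
by rewrite subrr sublinear0//; lra.
Qed.

Lemma sublinearZ q t x : sublinear q -> D x -> 0 <= t -> q (t *: x) = t * q x.
Proof.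
move=> sq Dx; rewrite le_eqVlt => /predU1P[<-|t0].
  by rewrite scale0r mul0r sublinear0.
apply/eqP; rewrite eq_le (sq.2 _ _ Dx (ltW t0))/=.
have := sq.2 t^-1 _ (DZ t Dx); rewrite invr_ge0 ltW// => /(_ isT).
by rewrite scalerA mulVf ?gt_eqF// scale1r ler_pdivlMl.
Qed.

(* The infimum over [t >= 0] of [q (x + t v) - t q v] is the largest sublinear
   functional below [q] whose value at [- v] is [- q v]. *)
Lemma sublinear_shrink q v : sublinear q -> D v ->
  exists2 q', sublinear q' &
    (forall x, D x -> q' x <= q x) /\ q' (- v) <= - q v.
Proof.
move=> sq Dv.
pose S x := [set q (x + t *: v) - t * q v | t in [set t : R | 0 <= t]].
have S0 x : S x !=set0 by exists (q (x + 0 *: v) - 0 * q v); exists 0 => /=.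
(* Subadditivity applied to [t v = (x + t v) + (- x)] keeps the infimum finite. *)
have lbS x : D x -> lbound (S x) (- q (- x)).
  move=> Dx _ [t /= t0 <-]; rewrite -(sublinearZ sq Dv t0).
  have := sq.1 _ _ (DD Dx (DZ t Dv)) (DN Dx).
  by rewrite addrAC subrr add0r; lra.
have infS x t : D x -> 0 <= t -> inf (S x) <= q (x + t *: v) - t * q v.
  by move=> Dx t0; apply: ge_inf; [exists (- q (- x)); exact: lbS | exists t].
(* The parameter [t = 0] gives [q' <= q], and [t = 1] at [- v] gives [q 0 - q v = - q v]. *)
exists (fun x => inf (S x)); last first.
  split=> [x Dx|].
    by have := infS x 0 Dx (lexx _); rewrite scale0r mul0r addr0 subr0.
  have := infS (- v) 1 (DN Dv) ler01.
  by rewrite scale1r addNr sublinear0// mul1r sub0r.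
split=> [x y Dx Dy|t x Dx t0].
  rewrite -lerBlDr; apply: lb_le_inf => // _ [s /= s0 <-].
  rewrite lerBlDr -lerBlDl; apply: lb_le_inf => // _ [t /= t0 <-].
  have := infS (x + y) (s + t) (DD Dx Dy) (addr_ge0 s0 t0).
  have := sq.1 _ _ (DD Dx (DZ s Dv)) (DD Dy (DZ t Dv)).
  by rewrite addrACA -scalerDl; lra.
move: t0; rewrite le_eqVlt => /predU1P[<-|t0].
  have := infS 0 0 D0 (lexx _).
  by rewrite !scale0r !mul0r addr0 sublinear0// subr0.
rewrite -ler_pdivrMl//; apply: lb_le_inf => // _ [s /= s0 <-].
rewrite ler_pdivrMl//.
have := infS (t *: x) (t * s) (DZ t Dx) (mulr_ge0 (ltW t0) s0).
rewrite -scalerA -scalerDr sublinearZ//; [by lra| |exact: ltW].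
exact: DD Dx (DZ s Dv).
Qed.

(** Lower bounds of chains, for Zorn's lemma. The pointwise infimum is finite because
    [- p (- x) <= - q (- x) <= q x], and subadditive because the smaller of two members of the chain
    serves both arguments. The empty chain is bounded by [p]. *)
Lemma sublinear_chain_inf (p : V -> R) (A : set (V -> R)) :
  sublinear p ->
  (forall q, A q -> sublinear q /\ forall x, D x -> q x <= p x) ->
  (forall q q', A q -> A q' -> (forall x, D x -> q x <= q' x) \/
                              (forall x, D x -> q' x <= q x)) ->
  exists q, [/\ sublinear q, (forall x, D x -> q x <= p x) &
    forall q', A q' -> forall x, D x -> q x <= q' x].
Proof.
move=> sp Ap Atot.
have [[q0 Aq0]|A0] := pselect (A !=set0); last first.
  by exists p; split => // q' Aq'; case: A0; exists q'.
pose S x := [set q x | q in A].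
have S0 x : S x !=set0 by exists (q0 x); exists q0.
have infS x q : D x -> A q -> inf (S x) <= q x.
  move=> Dx Aq; apply: ge_inf; last by exists q.
  exists (- p (- x)) => _ [q' /Ap[sq' q'p] <-].
  apply: le_trans (sublinearN sq' Dx).
  by rewrite lerN2 q'p//; exact: DN.
have inf_le x : D x -> inf (S x) <= p x.
  by move=> Dx; apply: le_trans (infS _ _ Dx Aq0) _; exact: (Ap _ Aq0).2.
exists (fun x => inf (S x)); split => //; last first.
  by move=> q' Aq' x Dx; exact: infS.
split=> [x y Dx Dy|t x Dx].
  rewrite -lerBlDr; apply: lb_le_inf => // _ [q1 Aq1 <-].
  rewrite lerBlDr -lerBlDl; apply: lb_le_inf => // _ [q2 Aq2 <-].
  have [le12|le21] := Atot _ _ Aq1 Aq2.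
    have := infS _ _ (DD Dx Dy) Aq1.
    by have := (Ap _ Aq1).1.1 _ _ Dx Dy; have := le12 _ Dy; lra.
  have := infS _ _ (DD Dx Dy) Aq2.
  by have := (Ap _ Aq2).1.1 _ _ Dx Dy; have := le21 _ Dx; lra.
rewrite le_eqVlt => /predU1P[<-|t0].
  rewrite scale0r mul0r; apply: le_trans (inf_le _ D0) _.
  by rewrite sublinear0.
rewrite -ler_pdivrMl//; apply: lb_le_inf => // _ [q Aq <-].
rewrite ler_pdivrMl//; apply: le_trans (infS _ _ (DZ t Dx) Aq) _.
by apply: (Ap _ Aq).1.2 => //; exact: ltW.
Qed.

(* A minimal sublinear functional is linear, by [sublinear_shrink]. *)
Theorem hahn_banach p v : sublinear p -> D v ->
  exists phi : V -> R,
    [/\ (forall x y, D x -> D y -> phi (x + y) = phi x + phi y),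
        (forall t x, D x -> phi (t *: x) = t * phi x),
        (forall x, D x -> phi x <= p x) & phi v = p v].
Proof.
(* Shrinking along [v] first forces the value at [v]: a linear [q <= p'] has
   [- q v <= p' (- v) <= - p v]. *)
move=> sp Dv; have [p' sp' [p'p p'v]] := sublinear_shrink sp Dv.
pose Q := {q : V -> R | sublinear q /\ forall x, D x -> q x <= p' x}.
pose q0 : Q := exist _ p' (conj sp' (fun x _ => lexx (p' x))).
(* The order is reversed, so that a maximal element for Zorn's lemma is a minimal functional. *)
pose below (q q' : Q) := `[< forall x, D x -> sval q' x <= sval q x >].
have [||A Atot|[q [sq qp']] qmin] := @ZL_preorder Q q0 below.
- by move=> q; apply/asboolP.
- move=> r s t /asboolP rs /asboolP st; apply/asboolP => x Dx.
  exact: le_trans (st _ Dx) (rs _ Dx).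
- have [|q q'|q [sq qp' qA]] :=
    @sublinear_chain_inf p' [set sval q | q in A] sp'.
  + by move=> _ [q _ <-]; exact: (svalP q).
  + move=> [r Ar <-] [s As <-].
    by have [/asboolP|/asboolP] := Atot _ _ Ar As; [right|left].
  + exists (exist _ q (conj sq qp')) => s As; apply/asboolP => /= x Dx.
    by apply: qA => //; exists s.
(* By minimality [q] is below its own shrinking along [x], whence [q (- x) <= - q x]. Oddness then
   turns the sublinear inequalities into equalities. *)
have qN x : D x -> q (- x) = - q x.
  move=> Dx; have [q' sq' [q'q q'x]] := sublinear_shrink sq Dx.
  have q'p' y : D y -> q' y <= p' y.
    by move=> Dy; apply: le_trans (q'q _ Dy) (qp' _ Dy).
  have /asboolP/= qq' := qmin (exist _ q' (conj sq' q'p')) (asboolT q'q).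
  apply/eqP; rewrite eq_le (le_trans (qq' _ (DN Dx)))//=.
  by have := sublinearN sq Dx; rewrite lerNl.
exists q; split => [x y Dx Dy|t x Dx|x Dx|].
- apply/eqP; rewrite eq_le sq.1//=.
  have := sq.1 _ _ (DD Dx Dy) (DN Dy).
  by rewrite addrK qN//; lra.
- have [t0|t0] := leP 0 t; first exact: sublinearZ.
  rewrite -[t]opprK scaleNr qN; last exact: DZ.
  by rewrite sublinearZ ?oppr_ge0 ?(ltW t0)// !mulNr.
- exact: le_trans (qp' _ Dx) (p'p _ Dx).
- apply/eqP; rewrite eq_le (le_trans (qp' _ Dv))/= ?p'p//.
  by have := qp' _ (DN Dv); rewrite qN//; lra.
Qed.

End hahn_banach.

(** * Exhaustion by a class of sets closed under countable unions *)

Section exhaustion.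
Context (d : measure_display) (T : measurableType d) (R : realType).
Variable nu : {finite_measure set T -> \bar R}.

(** The union of a maximizing sequence attains the supremum of [nu] on [C]. Adding a further member
    of [C] cannot increase its measure, and finiteness of [nu] allows cancelling [nu E]. *)
Lemma exhaustion (C : set (set T)) : C !=set0 ->
  (forall E, C E -> measurable E) ->
  (forall F : nat -> set T, (forall n, C (F n)) -> C (\bigcup_n F n)) ->
  exists2 E, C E & forall F, C F -> nu (F `\` E) = 0%E.
Proof.
move=> C0 mC bigcupC.
have nuC0 : nu @` C != set0.
  by apply/set0P; case: C0 => E CE; exists (nu E); exists E.
have [u uC ucvg] := ereal_sup_seq nuC0.
have /choice[F FP] n : exists E, C E /\ nu E = u n.
  by have [E CE <-] := uC n; exists E.
pose E := \bigcup_n F n.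
have CE : C E by apply: bigcupC => n; exact: (FP n).1.
have mE := mC _ CE.
have supE : (ereal_sup (nu @` C) <= nu E)%E.
  rewrite -(cvg_lim _ ucvg)//; apply: lime_le; first by apply/cvgP: ucvg.
  apply: nearW => n; rewrite -(FP n).2; apply: le_measure; rewrite ?inE//.
    by apply: mC; exact: (FP n).1.
  exact: bigcup_sup.
exists E => // G CG; have mG := mC _ CG.
have CEG : C (E `|` G).
  rewrite -[X in C X](_ : \bigcup_n (if n is 0%N then E else G) = _).
    by apply: bigcupC => -[].
  apply/seteqP; split=> [x [[|n] _ ?]|x [?|?]]; [by left|by right| |].
  - by exists 0%N.
  - by exists 1%N.
have : (nu (E `|` G) <= nu E)%E.
  by apply: le_trans supE; apply: ereal_sup_ubound; exists (E `|` G).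
have -> : E `|` G = E `|` (G `\` E) by rewrite setUDr setDv setD0.
have mGE : measurable (G `\` E) by exact: measurableD.
rewrite measureU//; last by rewrite setDIK.
have fE : nu E \is a fin_num by exact: fin_num_measure.
rewrite -[leRHS]adde0 leeD2lE// => h.
by apply/eqP; rewrite eq_le h measure_ge0.
Qed.

End exhaustion.

(** * Essentially bounded functions, complex and real *)

Section gauge.
Context (d : measure_display) (T : measurableType d) (R : realType).
Variable nu : probability T R.
Implicit Types (f g : T -> R[i]) (r s : T -> R).
Implicit Types mu : {measure set T -> \bar R}.

Lemma normc_real (x : R) : normc (x%:C)%C = `|x|.
Proof. by rewrite /normc /= expr0n addr0 sqrtr_sqr. Qed.

Lemma normc_ge0 (z : R[i]) : 0 <= normc z.
Proof. by case: z => a b; exact: sqrtr_ge0. Qed.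

Lemma normc_normr (z : R[i]) : `|z| = (normc z)%:C%C.
Proof. by rewrite normc_def; case: z. Qed.

Lemma LinftyP f : Linfty nu f <->
  [/\ measurable_fun [set: T] (fun x => complex.Re (f x)),
      measurable_fun [set: T] (fun x => complex.Im (f x)) &
      exists M, \forall x \ae nu, normc (f x) <= M].
Proof.
(* The norm of exponent [+oo] is an essential supremum only on a space of positive mass. *)
have nu0 : (0 < nu [set: T])%E by rewrite probability_setT.
have absE : abse \o (EFin \o (fun x => normc (f x))) =
    EFin \o (fun x => normc (f x)).
  by apply/funext => x; rewrite /= ger0_norm// normc_ge0.
split=> [[mRe mIm fin]|[mRe mIm [M fM]]]; split => //.
  move: fin; rewrite /finite_norm unlock nu0 absE.
  exact: ess_supr_bounded.
rewrite /finite_norm unlock nu0 absE.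
apply: (@le_lt_trans _ _ M%:E); last exact: ltry.
by apply/ess_supP; apply: filterS fM => x; rewrite lee_fin.
Qed.

Lemma measurable_normc f :
  measurable_fun [set: T] (fun x => complex.Re (f x)) ->
  measurable_fun [set: T] (fun x => complex.Im (f x)) ->
  measurable_fun [set: T] (fun x => normc (f x)).
Proof.
move=> mRe mIm.
rewrite (_ : (fun _ => _) =
    @Num.sqrt R \o (fun x => complex.Re (f x) ^+ 2 + complex.Im (f x) ^+ 2)).
  apply: measurableT_comp.
    exact: continuous_measurable_fun (@sqrt_continuous R).
  by apply: measurable_funD; exact: measurable_funX.
by apply/funext => x /=; case: (f x).
Qed.

(** The codomain [R^o] makes the functions a module over [R], in which this set is the subspace used
    for Hahn-Banach. *)
Definition Linfty_real : set (T -> R^o) :=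
  [set r | Linfty nu (fun x => (r x)%:C%C)].

Lemma Linfty_realP r : Linfty_real r <->
  measurable_fun [set: T] r /\ exists M, \forall x \ae nu, `|r x| <= M.
Proof.
rewrite /Linfty_real/= LinftyP; split=> [[mr _ [M rM]]|[mr [M rM]]].
  by split; [exact: mr|exists M; apply: filterS rM => x; rewrite normc_real].
split; [exact: mr|exact: measurable_cst|].
by exists M; apply: filterS rM => x; rewrite normc_real.
Qed.

Lemma Linfty_normc f : Linfty nu f -> Linfty_real (fun x => normc (f x)).
Proof.
move=> /LinftyP[mRe mIm [M fM]]; apply/Linfty_realP.
split; first exact: measurable_normc.
by exists M; apply: filterS fM => x; rewrite ger0_norm// normc_ge0.
Qed.

Lemma measurable_EFin_normc f : Linfty nu f ->
  measurable_fun [set: T] (fun x => (normc (f x))%:E).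
Proof.
by move=> /Linfty_normc/Linfty_realP[mf _]; exact/measurable_EFinP.
Qed.

Lemma Linfty_realD r s : Linfty_real r -> Linfty_real s ->
  Linfty_real (fun x => r x + s x).
Proof.
move=> /Linfty_realP[mr [M rM]] /Linfty_realP[ms [N sN]]; apply/Linfty_realP.
split; first exact: measurable_funD.
exists (M + N); apply: filterS2 rM sN => x rM sN.
by rewrite (le_trans (ler_normD _ _))// lerD.
Qed.

Lemma Linfty_realZ (t : R) r : Linfty_real r -> Linfty_real (fun x => t * r x).
Proof.
move=> /Linfty_realP[mr [M rM]]; apply/Linfty_realP.
split; first exact: measurable_funM.
by exists (`|t| * M); apply: filterS rM => x rM; rewrite normrM ler_wpM2l.
Qed.

Lemma Linfty_real_le r s : measurable_fun [set: T] r -> Linfty_real s ->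
  (forall x, `|r x| <= `|s x|) -> Linfty_real r.
Proof.
move=> mr /Linfty_realP[ms [M sM]] rs; apply/Linfty_realP; split => //.
by exists M; apply: filterS sM => x; exact: le_trans.
Qed.

Lemma Linfty_cst (c : R) : Linfty_real (fun=> c).
Proof.
apply/Linfty_realP; split; first exact: measurable_cst.
by exists `|c|; apply: nearW.
Qed.

Lemma Linfty_indic A : measurable A -> Linfty_real \1_A.
Proof.
move=> mA; apply: (Linfty_real_le _ (Linfty_cst 1)).
  exact: measurable_indic.
by move=> x; rewrite indicE normr1 normr_nat lern1 leq_b1.
Qed.

(** * Monotonicity of gauge norms and positive functionals below them *)

Variable alpha : (T -> R[i]) -> R.
Hypothesis alpha_gauge : normalized_gauge_norm nu alpha.

Let alpha_norm := gauge_norm_norm alpha_gauge.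

Lemma gauge_norm_normc f : Linfty nu f ->
  alpha (fun x => (normc (f x))%:C%C) = alpha f.
Proof.
move=> Lf; rewrite -(gauge_norm_abs alpha_gauge Lf).
by congr alpha; apply/funext => x; rewrite normc_normr.
Qed.

Lemma gauge_norm_eq f g : Linfty nu f -> Linfty nu g ->
  (forall x, normc (f x) = normc (g x)) -> alpha f = alpha g.
Proof.
move=> Lf Lg fg; rewrite -gauge_norm_normc// -(gauge_norm_normc Lg).
by congr alpha; apply/funext => x; rewrite fg.
Qed.

(* With [s = |f| <= |g| = m], [s] is the average of [s + i w] and [s - i w]
   where [w = sqrt (m^2 - s^2)], and these two functions have modulus [m]. *)
Lemma gauge_norm_le f g : Linfty nu f -> Linfty nu g ->
  (forall x, normc (f x) <= normc (g x)) -> alpha f <= alpha g.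
Proof.
move=> Lf Lg fg.
pose s x := normc (f x); pose m x := normc (g x).
pose w x := Num.sqrt (m x ^+ 2 - s x ^+ 2).
have Ls := Linfty_normc Lf; have Lm := Linfty_normc Lg.
have [/Linfty_realP[ms _] /Linfty_realP[mm bm]] := (Ls, Lm).
have mw : measurable_fun [set: T] w.
  apply: measurableT_comp.
    exact: continuous_measurable_fun (@sqrt_continuous R).
  by apply: measurable_funB; exact: measurable_funX.
have normF (e : R) x : `|e| = 1 -> normc (s x +i* (e * w x))%C = m x.
  move=> e1; rewrite /normc/= exprMn -[e ^+ 2]real_normK ?num_real// e1.
  rewrite expr1n mul1r.
  rewrite sqr_sqrtr ?subr_ge0 ?ler_sqr ?nnegrE ?normc_ge0//; last exact: fg.
  by rewrite addrC subrK sqrtr_sqr ger0_norm// normc_ge0.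
have LF (e : R) : `|e| = 1 -> Linfty nu (fun x => (s x +i* (e * w x))%C).
  move=> e1; apply/LinftyP; split; [exact: ms|exact: measurable_funM|].
  have [M mM] := bm; exists M; apply: filterS mM => x.
  by rewrite normF//; apply: le_trans; exact: ler_norm.
have F1 (e : R) : `|e| = 1 -> alpha (fun x => (s x +i* (e * w x))%C) = alpha g.
  by move=> e1; apply: gauge_norm_eq => //; [exact: LF|move=> x; rewrite normF].
have n1 : `|1 : R| = 1 by rewrite normr1.
have nN1 : `|- 1 : R| = 1 by rewrite normrN1.
have := Linfty_normD alpha_norm (LF _ n1) (LF _ nN1).
rewrite !F1// [X in alpha X](_ : _ = (fun x => 2%:R%:C%C * (s x)%:C%C)).
  rewrite (Linfty_normZ alpha_norm)// normc_real gauge_norm_normc// normr_nat.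
  lra.
by apply/funext => x; apply/eqP; rewrite eq_complex/=; apply/andP; split;
  apply/eqP; ring.
Qed.

Local Notation indicR A := (\1_A : T -> R).

Lemma indic_complex A : (fun x => (indicR A x)%:C%C) = (\1_A : T -> R[i]).
Proof. by apply/funext => x; rewrite !indicE; case: (x \in A). Qed.

(** Hahn-Banach is applied to [p r = alpha (r^+)] and not to [alpha] itself, since the bound by [p]
    also yields positivity. As [v >= 0], [p v] is [alpha v]. *)
Lemma gauge_norm_functional (v : T -> R^o) :
  Linfty_real v -> (forall x, 0 <= v x) ->
  exists phi : (T -> R^o) -> R,
    [/\ (forall r s, Linfty_real r -> Linfty_real s ->
          phi (r + s) = phi r + phi s),
        (forall t r, Linfty_real r -> phi (t *: r) = t * phi r),
        (forall r, Linfty_real r -> (forall x, 0 <= r x) ->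
          0 <= phi r <= alpha (fun x => (r x)%:C%C)) &
        phi v = alpha (fun x => (v x)%:C%C)].
Proof.
move=> Lv v0.
pose pos (r : T -> R) x : R := Num.max (r x) 0.
pose p (r : T -> R^o) := alpha (fun x => (pos r x)%:C%C).
have pos_id r : (forall x, 0 <= r x) -> pos r = r.
  by move=> r0; apply/funext => x; rewrite /pos; apply/max_idPl.
have Lpos r : Linfty_real r -> Linfty_real (pos r).
  move=> Lr; have /Linfty_realP[mr _] := Lr.
  apply: (Linfty_real_le _ Lr) => [|x].
    by apply: measurable_maxr => //; exact: measurable_cst.
  rewrite /pos; case: (leP (r x) 0) => // _; by rewrite normr0.
have leA r s : Linfty_real r -> Linfty_real s -> (forall x, 0 <= r x <= s x) ->
    alpha (fun x => (r x)%:C%C) <= alpha (fun x => (s x)%:C%C).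
  move=> Lr Ls rs; apply: gauge_norm_le => // x; have /andP[r0 rsx] := rs x.
  by rewrite !normc_real !ger0_norm// (le_trans r0).
have LD r s : Linfty_real r -> Linfty_real s -> Linfty_real (r + s).
  exact: Linfty_realD.
have LZ (t : R) (r : T -> R^o) : Linfty_real r -> Linfty_real (t *: r).
  exact: Linfty_realZ.
have sp : sublinear (Linfty_real : set (T -> R^o)) p.
  split=> [r s Lr Ls|t r Lr t0].
    apply: le_trans (Linfty_normD alpha_norm (Lpos _ Lr) (Lpos _ Ls)).
    (* Subadditivity of [p] combines [(r + s)^+ <= r^+ + s^+] with monotonicity of [alpha]. *)
    rewrite [X in _ <= alpha X](_ : _ = fun x => (pos r x + pos s x)%:C%C).
      apply: leA; [exact/Lpos/LD|exact: Linfty_realD (Lpos _ Lr) (Lpos _ Ls)|].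
      move=> x; rewrite /pos le_max lexx orbT/= ge_max.
      by rewrite lerD ?le_max ?lexx// addr_ge0// le_max lexx orbT.
    by apply/funext => x; rewrite rmorphD.
  rewrite -[X in X * _]ger0_norm// -normc_real.
  rewrite -(Linfty_normZ alpha_norm); last exact: Lpos.
  rewrite le_eqVlt; apply/orP; left; apply/eqP; congr alpha.
  by apply/funext => x; rewrite -rmorphM /pos maxr_pMr// mulr0.
have [phi [phiD phiZ phip phiv]] :=
  hahn_banach (Linfty_cst 0) LD LZ sp Lv.
exists phi; split => //; last by rewrite phiv /p pos_id.
move=> r Lr r0; apply/andP; split; last first.
  by apply: le_trans (phip _ Lr) _; rewrite /p pos_id.
(* For [r >= 0] the positive part of [- r] vanishes, so [- phi r <= alpha 0 = 0]. *)
have := phip _ (LZ (-1) _ Lr).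
rewrite phiZ// mulN1r /p (_ : pos _ = fun=> 0); last first.
  apply/funext => x; rewrite /pos; apply/max_idPr.
  by rewrite /= scaleN1r oppr_le0.
rewrite (_ : alpha _ = 0) ?oppr_le0//.
have := Linfty_normZ alpha_norm 0 (Linfty_cst 0).
by rewrite normc0 !mul0r.
Qed.

(** * Measures dominated by the gauge norm *)

Lemma measure_of_semi_sigma_additive (m : set T -> \bar R) :
  m set0 = 0%E -> (forall A, 0 <= m A)%E -> semi_sigma_additive m ->
  exists mu : {measure set T -> \bar R}, mu = m :> (set T -> \bar R).
Proof.
move=> m0 mge0 msa.
pose mu : {measure set T -> \bar R} :=
  HB.pack m (isMeasure.Build d T R m m0 mge0 msa).
by exists mu.
Qed.

Definition dominated_measure (mu : {measure set T -> \bar R}) :=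
  forall f, Linfty nu f -> (\int[mu]_x (normc (f x))%:E <= (alpha f)%:E)%E.

Hypothesis alpha_cont : continuous_norm nu alpha.

(** The measure is [A |-> phi 1_A], with [phi] touching [alpha] at [1_E]. Its integral agrees with
    [phi] on simple functions [h], and [h <= |f|] gives [phi h <= alpha h <= alpha f]; the integral
    of [|f|] is the supremum over such [h]. *)
Lemma exists_dominated_measure E : measurable E ->
  exists2 mu : {measure set T -> \bar R}, dominated_measure mu &
    mu E = (alpha \1_E)%:E.
Proof.
move=> mE.
have [phi [phiD phiZ phi_bnd phiE]] :=
  gauge_norm_functional (Linfty_indic mE) (fun x => ler0n R (x \in E)).
have phi_indic A : measurable A -> 0 <= phi (indicR A) <= alpha \1_A.
  by move=> mA; rewrite -indic_complex phi_bnd//; exact: Linfty_indic.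
have phiU A B : measurable A -> measurable B -> A `&` B = set0 ->
    phi (indicR (A `|` B)) = phi (indicR A) + phi (indicR B).
  move=> mA mB AB; rewrite -phiD; [|exact: Linfty_indic..].
  congr phi; apply/funext => x.
  have [Bx|nBx] := boolP (x \in B).
    have nAx : x \notin A.
      apply/negP => Ax; have : (A `&` B) x by split; exact: set_mem.
      by rewrite AB.
    by rewrite fctE !indicE in_setU Bx (negbTE nAx) add0r.
  by rewrite fctE !indicE in_setU (negbTE nBx) orbF addr0.
(* The value 0 on nonmeasurable sets secures nonnegativity on all sets, as [phi] is controlled only
   on [Linfty_real]. *)
pose m A : \bar R :=
  if pselect (measurable A) is left _ then (phi (indicR A))%:E else 0%E.
have mM A : measurable A -> m A = (phi (indicR A))%:E.
  by rewrite /m; case: pselect.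
have m0 : m set0 = 0%E.
  rewrite mM//; congr EFin.
  have := phiU _ _ measurable0 measurable0 (setI0 _).
  by rewrite setU0; lra.
have mge0 A : (0 <= m A)%E.
  rewrite /m; case: pselect => // mA.
  by have /andP[] := phi_indic _ mA; rewrite lee_fin.
have msa : semi_sigma_additive m.
  move=> F mF tF mUF.
  (* The tails [G n] measure the defect of the partial sums. They decrease to the empty set, so
     continuity of [alpha] sends [phi 1_(G n)] to 0. *)
  pose G n := \bigcup_(i in [set i | (n <= i)%N]) F i.
  have mG n : measurable (G n) by exact: bigcup_measurable.
  have G0 : G 0%N = \bigcup_n F n by apply: eq_bigcupl; split.
  have FG n : phi (indicR (G n)) = phi (indicR (F n)) + phi (indicR (G n.+1)).
    rewrite -phiU//.
      congr (phi (indic _)); apply/seteqP; split=> [x [i /= ni Fx]|x].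
        move: ni; rewrite leq_eqVlt => /predU1P[ni|ni].
          by left; rewrite ni.
        by right; exists i.
      case=> [Fx|[i /= ni Fx]]; first by exists n => /=.
      by exists i => //=; exact: ltnW.
    apply/seteqP; split=> // x [Fx [i /= ni Fix]].
    have ni' := tF n i I I (ex_intro _ x (conj Fx Fix)).
    by rewrite ni' ltnn in ni.
  have sumE n : (\sum_(0 <= i < n) m (F i) =
      (phi (indicR (\bigcup_n F n)) - phi (indicR (G n)))%:E)%E.
    elim: n => [|n ih]; first by rewrite big_nil G0 subrr.
    by rewrite big_nat_recr//= ih mM// -EFinD FG; congr EFin; lra.
  under eq_fun do rewrite sumE.
  rewrite mM//; apply: cvg_EFin; first exact: nearW.
  rewrite -[X in _ --> X]subr0; apply: cvgB; first exact: cvg_cst.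
  have nuG : nu (G n) @[n --> \oo] --> 0%E.
    rewrite -(measure0 nu) (_ : set0 = \bigcap_n G n).
      apply: nonincreasing_cvg_mu => //.
      - by rewrite -ge0_fin_numE// fin_num_measure.
      - exact: bigcapT_measurable.
      - move=> i j ij; apply/subsetPset => x [k /= jk Fx].
        by exists k => //=; exact: leq_trans jk.
    (* A point of all tails lies in some [F i] and in some [F j] with [j > i], against
       disjointness. *)
    apply/seteqP; split=> // x Gx; have [i _ Fix] := Gx 0%N I.
    have [j /= ij Fjx] := Gx i.+1 I.
    have ij' := tF i j I I (ex_intro _ x (conj Fix Fjx)).
    by rewrite ij' ltnn in ij.
  apply: (squeeze_cvgr _ (cvg_cst 0) (alpha_cont mG nuG)).
  by apply: nearW => n; exact: phi_indic.
have [mu muE] := measure_of_semi_sigma_additive m0 mge0 msa.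
exists mu; last by rewrite muE mM// phiE indic_complex.
move=> f Lf.
rewrite ge0_integralTE; last by move=> x; rewrite lee_fin normc_ge0.
apply: ge_ereal_sup => _ [h hf <-].
have h0 x : 0 <= h x by exact: fun_ge0.
have Lh : Linfty_real h.
  apply: (Linfty_real_le _ (Linfty_normc Lf)); first exact: measurable_funPT.
  move=> x; rewrite !ger0_norm ?normc_ge0//.
  by rewrite -lee_fin.
apply: (@le_trans _ _ (alpha (fun x => (h x)%:C%C))%:E); last first.
  rewrite lee_fin; apply: gauge_norm_le => // x.
  by rewrite normc_real ger0_norm// -lee_fin.
have phi_sum (I : Type) (c : I -> R) (A : I -> set T) (u : seq I) :
    (forall i, measurable (A i)) ->
    phi (fun x => \sum_(i <- u) c i * indicR (A i) x) =
    \sum_(i <- u) c i * phi (indicR (A i)).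
  move=> mA.
  have L1 i : Linfty_real (fun x => c i * indicR (A i) x).
    exact/Linfty_realZ/Linfty_indic.
  have LS w : Linfty_real (fun x => \sum_(i <- w) c i * indicR (A i) x).
    elim: w => [|i w ih].
      by under eq_fun do rewrite big_nil; exact: Linfty_cst.
    by under eq_fun do rewrite big_cons; exact: Linfty_realD.
  elim: u => [|i u ih].
    rewrite big_nil; under eq_fun do rewrite big_nil.
    rewrite -[X in phi X](scale0r (indicR E : T -> R^o)) phiZ ?mul0r//.
    exact: Linfty_indic.
  rewrite big_cons -ih -phiZ; last exact: Linfty_indic.
  rewrite -phiD; [|exact: L1|exact: LS].
  by congr phi; apply/funext => x; rewrite big_cons.
have mh y : measurable (h @^-1` [set y]) by exact: measurable_sfunP.
rewrite sintegralE.
under eq_fsbigr do rewrite muE mM// -EFinM.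
rewrite fsumEFin// lee_fin.
have := phi_bnd _ Lh h0 => /andP[_]; apply: le_trans.
rewrite fsbig_finite//= -(phi_sum _ id (fun y => h @^-1` [set y]))//.
rewrite le_eqVlt; apply/orP; left; apply/eqP; congr phi; apply/funext => x.
by rewrite [RHS]fimfunE fsbig_finite.
Qed.

Lemma dominated_measure_le mu A : dominated_measure mu -> measurable A ->
  (mu A <= (alpha \1_A)%:E)%E.
Proof.
move=> domu mA; have := domu _ (Linfty_indic mA).
rewrite indic_complex; apply: le_trans.
rewrite -[A in mu A]setIT -integral_indic//.
under [leRHS]eq_integral do rewrite normc_real ger0_norm//.
exact: lexx.
Qed.

(** The indicator of a [nu]-null set is almost everywhere 0, so [alpha] vanishes on it. *)
Lemma dominated_measure_null mu : dominated_measure mu ->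
  forall A, measurable A -> nu A = 0%E -> mu A = 0%E.
Proof.
move=> domu A mA nuA; apply/eqP; rewrite eq_le measure_ge0 andbT.
apply: le_trans (dominated_measure_le domu mA) _.
have -> : alpha \1_A = alpha (fun=> 0).
  apply: (Linfty_norm_ae alpha_norm).
  - by rewrite -indic_complex; exact: Linfty_indic.
  - exact: (Linfty_cst 0).
  - exists A; split=> // x; apply: contra_notP => nAx _ /=.
    by rewrite indicE memNset.
have := Linfty_normZ alpha_norm 0 (Linfty_cst 0).
by rewrite normc0 !mul0r => ->.
Qed.

Lemma dominated_measure_series (mu_ : {measure set T -> \bar R}^nat) :
  (forall n, dominated_measure (mu_ n)) ->
  exists2 mu, dominated_measure mu &
    forall A, mu A = 0%E -> forall n, mu_ n A = 0%E.
Proof.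
move=> domu.
(* The exponent [n.+1] makes the weights sum to 1, which preserves domination; they are positive, so
   a null set of the sum is null for every term. *)
have w0 n : 0 <= 1 / (2 ^ n.+1)%:R :> R by rewrite divr_ge0.
pose mu := mseries (fun n => mscale (NngNum (w0 n)) (mu_ n)) 0.
exists mu => [f Lf|A muA n].
  have m0 x : (0 <= (normc (f x))%:E)%E by rewrite lee_fin normc_ge0.
  have mf := measurable_EFin_normc Lf.
  have a0 : 0 <= alpha f by exact: (Linfty_norm_ge0 alpha_norm).
  rewrite ge0_integral_measure_series//.
  apply: le_trans (epsilon_trick0 xpredT a0).
  apply: lee_nneseries => n; first by move=> *; exact: integral_ge0.
  move=> _.
  rewrite ge0_integral_mscale//= mul1r mulrC EFinM.
  by apply: lee_wpmul2l; [rewrite lee_fin|exact: domu].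
have : (mscale (NngNum (w0 n)) (mu_ n) A <= 0)%E.
  rewrite -muA; apply: le_trans (nneseries_lim_ge n.+1 _); last by [].
  by rewrite big_nat_recr//= leeDr// sume_ge0.
rewrite /mscale/= => h; apply/eqP; rewrite eq_le measure_ge0 andbT.
by move: h; rewrite pmule_rle0// lte_fin mul1r invr_gt0.
Qed.

(** * Null sets and a dominated measure equivalent to [nu] *)

Lemma bigcup_null mu (F : nat -> set T) : (forall n, measurable (F n)) ->
  (forall n, mu (F n) = 0%E) -> mu (\bigcup_n F n) = 0%E.
Proof.
move=> mF F0; apply/negligibleP; first exact: bigcupT_measurable.
by apply: negligible_bigcup => n; apply/negligibleP; [exact: mF|exact: F0].
Qed.

(** Exhaustion with [nu] over the [mu]-null sets, which are closed under countable unions; largest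
    means up to [nu]-null sets. *)
Lemma exists_largest_null mu : exists N, [/\ measurable N, mu N = 0%E &
  forall F, measurable F -> mu F = 0%E -> nu (F `\` N) = 0%E].
Proof.
have [||F CF|N [mN N0] maxN] :=
    @exhaustion d T R nu [set A | measurable A /\ mu A = 0%E].
- by exists set0; split.
- by move=> A [].
- split; first by apply: bigcupT_measurable => n; exact: (CF n).1.
  by apply: bigcup_null => n; [exact: (CF n).1|exact: (CF n).2].
- by exists N; split => // F mF F0; exact: maxN.
Qed.

(* Halmos and Savage: exhaust [T] by the sets on which some dominated measure
   detects all [nu]-positive subsets.  The largest such set [E] is [nu]-conull:
   otherwise a dominated measure charging [~` E] detects all the [nu]-positive
   subsets of the complement [~` N] of its largest null set [N], so that
   [~` N] is [nu]-almost contained in [E]. *)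
Lemma exists_equivalent_dominated_measure :
  exists2 mu, dominated_measure mu & forall A, measurable A ->
    mu A = 0%E -> nu A = 0%E.
Proof.
pose detects mu E :=
  forall A, measurable A -> A `<=` E -> mu A = 0%E -> nu A = 0%E.
have [||F CF|E [mE [mu domu detE]] maxE] := @exhaustion d T R nu
    [set E | measurable E /\ exists2 mu, dominated_measure mu & detects mu E].
- have [mu domu _] := exists_dominated_measure measurable0.
  exists set0; split => //; exists mu => // A mA; rewrite subset0 => -> _.
  exact: measure0.
- by move=> A [].
- have mF n := (CF n).1.
  split; first exact: bigcupT_measurable.
  (* The weighted series of the measures for the [F n] detects on the union: a null [A] is cut into
     the pieces [A] meets [F n]. *)
  have /choice[mu_ mu_P] n :
      exists mu, dominated_measure mu /\ detects mu (F n).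
    by have [_ [mu]] := CF n; exists mu.
  have [mu domu mu0] := dominated_measure_series (fun n => (mu_P n).1).
  exists mu => // A mA AF muA.
  rewrite -(setIidl AF) setI_bigcupr; apply: bigcup_null => n.
    exact: measurableI.
  apply: (mu_P n).2 => //; first exact: measurableI.
  apply: (subset_measure0 _ mA) => //; first exact: measurableI.
  exact: mu0.
have mE' : measurable (~` E) by exact: measurableC.
have nuE' : nu (~` E) = 0%E.
  have [mu' domu' mu'E] := exists_dominated_measure mE'.
  have [N [mN mu'N maxN]] := exists_largest_null mu'.
  have mN' : measurable (~` N) by exact: measurableC.
  have nuNE : nu (~` N `\` E) = 0%E.
    apply: maxE; split=> //; exists mu' => // A mA AN mu'A.
    by rewrite -(maxN _ mA mu'A) setDidl//; apply/disjoints_subset.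
  have mu'E0 : mu' (~` E) = 0%E.
    have -> : ~` E = (~` E `&` N) `|` (~` N `\` E).
      by rewrite setDE [~` N `&` _]setIC -setIUr setUv setIT.
    rewrite measureU0.
    - by apply: (subset_measure0 _ mN) => //; exact: measurableI.
    - exact: measurableI.
    - exact: measurableD.
    - by apply: dominated_measure_null => //; exact: measurableD.
  have aE : alpha \1_(~` E) = 0.
    by have := mu'E; rewrite mu'E0 => -[].
  have LE : Linfty nu (\1_(~` E) : T -> R[i]).
    by rewrite -indic_complex; exact: Linfty_indic.
  have [M [mM M0 sub]] := Linfty_norm_eq0 alpha_norm LE aE.
  apply: (subset_measure0 _ mM) => // x nEx; apply: sub => /= /(_ I).
  by rewrite indicE mem_set// => /eqP; rewrite oner_eq0.
exists mu => // A mA muA.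
have nuAE : nu (A `&` E) = 0%E.
  apply: detE => //; first exact: measurableI.
  by apply: (subset_measure0 _ mA) => //; exact: measurableI.
rewrite -(setIT A) -(setUv E) setIUr measureU0 //.
- exact: measurableI.
- exact: measurableI.
- by apply: (subset_measure0 _ mE') => //; exact: measurableI.
Qed.

(** * Convex combinations and passage to probabilities *)

Lemma dominated_measure_convex (t : R) (mu1 mu2 : {measure set T -> \bar R}) :
  0 <= t <= 1 -> dominated_measure mu1 -> dominated_measure mu2 ->
  exists2 mu, dominated_measure mu &
    forall A, (mu A = (1 - t)%:E * mu1 A + t%:E * mu2 A)%E.
Proof.
move=> /andP[t0 t1] dom1 dom2.
have t1' : 0 <= 1 - t by rewrite subr_ge0.
exists (measure_add (mscale (NngNum t1') mu1) (mscale (NngNum t0) mu2));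
  last first.
  by move=> A; exact: measure_addE.
move=> f Lf.
have m0 x : (0 <= (normc (f x))%:E)%E by rewrite lee_fin normc_ge0.
have mf := measurable_EFin_normc Lf.
rewrite ge0_integral_measure_add// !ge0_integral_mscale//=.
have -> : alpha f = (1 - t) * alpha f + t * alpha f by ring.
rewrite [leRHS]EFinD !EFinM.
by apply: leeD; apply: lee_wpmul2l; rewrite ?lee_fin//;
  [exact: dom1|exact: dom2].
Qed.

Lemma probability_of_measure mu : mu [set: T] = 1%E ->
  exists P : probability T R, P = mu :> (set T -> \bar R).
Proof.
move=> mu1.
pose m A := mu A.
have m0 : m set0 = 0%E := measure0 mu.
have mge0 A : (0 <= m A)%E := measure_ge0 mu A.
have msa : semi_sigma_additive m := @measure_semi_sigma_additive _ _ _ mu.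
pose M := isMeasure.Build d T R m m0 mge0 msa.
pose mM : {measure set T -> \bar R} := HB.pack m M.
pose P : probability T R :=
  HB.pack m mM (Measure_isProbability.Build d T R mM mu1).
by exists P.
Qed.

End gauge.

(** * Construction of [c] and [lambda] *)

Theorem theorem2p2 (d : measure_display) (T : measurableType d) (R : realType)
    (nu : probability T R) (alpha : (T -> R[i]) -> R) (eps : R)
    (alpha_gauge : normalized_gauge_norm nu alpha)
    (alpha_cont : continuous_norm nu alpha)
    (eps_gt0 : 0 < eps) :
  exists (c : R) (lambda : probability T R),
    [/\ 1 - eps < c, c <= 1, mutually_ac nu lambda
      & L1_dominating nu c lambda alpha].
Proof.
(* Since [mu1] has mass 1, the mixture has mass [c >= 1 - t]. Thus [t < eps] gives [1 - eps < c],
   [t < 1] gives [c > 0], and [t > 0] keeps the equivalent measure in the mixture. *)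
pose t := Num.min (eps / 2) (1 / 2).
have [t0 t1 te] : [/\ 0 < t, t < 1 & t < eps].
  rewrite /t lt_min !gt_min; split; rewrite ?divr_gt0//; apply/orP.
    by right; lra.
  by left; lra.
have alphaT : alpha \1_[set: T] = 1.
  by rewrite -(gauge_norm1 alpha_gauge) indicT.
have [mu1 dom1] := exists_dominated_measure alpha_gauge alpha_cont measurableT.
rewrite alphaT => mu1T.
have [mu2 dom2 nu_mu2] :=
  exists_equivalent_dominated_measure alpha_gauge alpha_cont.
have [|mu domu muE] := dominated_measure_convex _ dom1 dom2 (t := t).
  by rewrite !ltW.
have muT1 : (mu [set: T] <= 1%:E)%E.
  by rewrite -alphaT; exact: (dominated_measure_le (nu := nu)).
have muTfin : mu [set: T] \is a fin_num.
  by rewrite ge0_fin_numE// (le_lt_trans muT1)// ltry.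
pose c := fine (mu [set: T]).
have cE : mu [set: T] = c%:E by rewrite /c fineK.
have c1 : c <= 1 by rewrite -lee_fin -cE.
have tc : 1 - t <= c.
  by rewrite -lee_fin -cE muE mu1T mule1 leeDl// mule_ge0// lee_fin ltW.
have c0 : 0 < c by lra.
have ci0 : 0 <= c^-1 by rewrite invr_ge0 ltW.
have [|P PE] := @probability_of_measure d T R (mscale (NngNum ci0) mu).
  by rewrite /= /mscale/= cE -EFinM mulVf// gt_eqF.
have PmuE A : P A = (c^-1%:E * mu A)%E by rewrite PE.
exists c, P; split => //; first by lra.
  split; apply/null_content_dominatesP => A mA.
    move=> nuA; rewrite PmuE.
    by rewrite (dominated_measure_null alpha_gauge domu mA nuA) mule0.
  (* A null set of [P] is null for [mu], hence for [mu2], because [t mu2 <= mu] with [t > 0]. *)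
  move=> PA; apply: nu_mu2 => //.
  have : (mu A <= 0)%E.
    rewrite -(@pmule_rle0 _ c^-1%:E) ?lte_fin ?invr_gt0//.
    by rewrite -PmuE PA.
  rewrite muE => h.
  have : (t%:E * mu2 A <= 0)%E.
    apply: le_trans h; rewrite leeDr// mule_ge0// lee_fin; lra.
  rewrite pmule_rle0 ?lte_fin// => h2.
  by apply/eqP; rewrite eq_le h2 measure_ge0.
split=> // f Lf.
have mf := measurable_EFin_normc Lf.
(* The factor [c] cancels the normalisation [c^-1], which leaves the domination of [mu]. *)
rewrite (eq_measure_integral (mscale (NngNum ci0) mu)); last first.
  by move=> A _ _; exact: PmuE.
rewrite ge0_integral_mscale//; last by move=> x _; rewrite lee_fin normc_ge0.
rewrite muleA -EFinM mulfV ?gt_eqF// mul1e.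
exact: domu.
Qed.
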